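(* Let $(X,d_X)$ be an $n$-point metric space which is $(t,\delta)$-decomposable. Then for every $\epsilon\in(0,1/8)$ there is a $t\cdot(2+\epsilon)$-spanner for $X$ with lightness $O_\epsilon\!\left(\frac{t}{\delta}\cdot\log^2 n\right)$ and with $O_\epsilon\!\left(\frac{n}{\delta}\cdot\log n\cdot\log t\right)$ edges.
   Context: A $(t,\Delta,\delta)$-decomposition of a metric space $(X,d_X)$ (for $t\ge1$, $\Delta>0$, $\delta\in[0,1]$) is a probability distribution over partitions of $X$ such that every partition in the support has all clusters of diameter at most $t\cdot\Delta$, and every two points $x,y$ with $d_X(x,y)\le\Delta$ lie in the same cluster with probability at least $\delta$. The metric is $(t,\delta)$-decomposable (where $\delta$ may depend on $|X|$ and $t$) if it admits a $(t,\Delta,\delta)$-decomposition for every $\Delta>0$. A $k$-spanner of $(X,d_X)$ is a weighted graph $H$ on vertex set $X$, each edge $\{x,y\}$ having weight $d_X(x,y)$, such that $d_X(x,y)\le d_H(x,y)\le k\cdot d_X(x,y)$ for all $x,y\in X$, where $d_H$ is the shortest-path metric of $H$. The lightness of $H$ is its total edge weight divided by the weight of a minimum spanning tree of $X$. The notation $O_\epsilon(f)$ means $O(f)\cdot\mathrm{poly}(1/\epsilon)$; logarithms are base 2.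
   Formalization: In the edge bound, log t is read as max(1, log t), since for t = 1 the literal bound is 0 edges, which fails already for a two-point space with δ = 1; moreover δ > 0 is assumed so that t/δ and n/δ are defined. *)

(* Defs.v *)
From HB Require Import structures.
From mathcomp Require Import all_boot all_order all_algebra.
From mathcomp Require Import all_classical all_reals all_analysis.

Set Implicit Arguments.
Unset Strict Implicit.
Unset Printing Implicit Defensive.

Import Order.TTheory GRing.Theory Num.Theory.

Local Open Scope ring_scope.

(* Every metric on a finite type gives such a structure: the uniform and
   topological fields of metricType are determined by the distance mdist. *)
#[short(type="finMetricType")]
HB.structure Definition FinMetric (R : numDomainType) :=
  {X of Finite X & Metric R X}.

Definition log2 {R : realType} (x : R) : R := ln x / ln 2.

Section Decompositions.
Context {R : realType} {X : finMetricType R}.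
Implicit Types (C : {set X}) (P : {set {set X}}).

Definition diameter C : R :=
  \big[Num.max/0]_(x in C) \big[Num.max/0]_(y in C) mdist x y.

Definition same_cluster P (x y : X) : bool :=
  [exists C in P, (x \in C) && (y \in C)].

(* A distribution over the (finitely many) partitions of X is given by its
   probability mass function mu. *)
Definition decomposition (t Delta delta : R)
    (mu : {ffun {set {set X}} -> R}) : Prop :=
  [/\ (forall P, 0 <= mu P) /\ \sum_P mu P = 1,
      forall P, mu P != 0 -> finset.partition P [set: X],
      forall P, mu P != 0 -> forall C, C \in P -> diameter C <= t * Delta
    & forall x y : X, mdist x y <= Delta ->
        delta <= \sum_(P | same_cluster P x y) mu P].

End Decompositions.

Definition decomposable {R : realType} (X : finMetricType R) (t delta : R) :
    Prop :=
  forall Delta : R, 0 < Delta ->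
    exists mu : {ffun {set {set X}} -> R}, decomposition t Delta delta mu.

Section Graphs.
Context {R : realType} {X : finMetricType R}.

(* A graph on the vertex set X is given by its edge set, a set of unordered
   pairs {x, y} with x != y; the weights are those induced by the metric. *)
Definition is_graph (H : {set {set X}}) : Prop :=
  forall e, e \in H -> #|e| = 2%N.

Definition adj (H : {set {set X}}) : rel X :=
  fun x y => ([set x; y] \in H)%SET.

(* The weight of an edge {x, y} is mdist x y, which is the diameter of the
   two-point set {x, y}. *)
Lemma edge_weightE (x y : X) : diameter [set x; y]%SET = mdist x y.
Proof.
rewrite /diameter; apply/le_anti/andP; split.
  apply: bigmax_le => [|u]; first exact: mdist_ge0.
  rewrite !inE => /orP[]/eqP->; (apply: bigmax_le => [|v]; first exact: mdist_ge0);
    rewrite !inE => /orP[]/eqP->; by rewrite ?mdistxx ?mdist_ge0 // metric_sym.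
apply: (le_trans _ (le_bigmax_cond _ _ (_ : x \in [set x; y]%SET))) => //.
  by apply: le_bigmax_cond; rewrite !inE eqxx orbT.
by rewrite !inE eqxx.
Qed.

Definition weight (H : {set {set X}}) : R := \sum_(e in H) diameter e.

Definition walk_length (x : X) (p : seq X) : R :=
  \sum_(w <- pairmap mdist x p) w.

(* Shortest-path distance: the walk visits x and then the vertices of p. It is
   +oo when x and y are not connected in H. *)
Definition graph_dist (H : {set {set X}}) (x y : X) : \bar R :=
  ereal_inf [set (walk_length x p)%:E | p in
    [set p : seq X | path (adj H) x p /\ last x p = y]]%classic.

Definition spanner (k : R) (H : {set {set X}}) : Prop :=
  is_graph H /\
  forall x y : X,
    ((mdist x y)%:E <= graph_dist H x y)%E /\
    (graph_dist H x y <= (k * mdist x y)%:E)%E.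

Definition acyclic (H : {set {set X}}) : Prop :=
  forall c : seq X, (2 < size c)%N -> ~ ucycle (adj H) c.

Definition spanning_tree (H : {set {set X}}) : Prop :=
  [/\ is_graph H, forall x y : X, connect (adj H) x y & acyclic H].

(* X has finitely many spanning trees and at least one (any spanning tree of
   the complete graph), so this infimum is a minimum. *)
Definition mst_weight : R := inf [set weight H | H in spanning_tree]%classic.

Definition lightness (H : {set {set X}}) : R := weight H / mst_weight.

End Graphs.

(* Main.v *)
(* Order the points greedily, each one farthest from its predecessors, with
   insertion radii rho_0 >= rho_1 >= ...  For every r the points with rho_k > r
   form an r-separated r-net, so these nets are nested.  At each scale
   D = d0 (1 + e)^i, the non-isolated points of the (e D)-net are joined by stars
   inside the clusters of O(log n / delta) partitions, chosen by averaging so that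
   net points within (1 + 2e) D share a cluster in one of them; a pair of points
   is routed through its net points at its own scale, and the two detours are
   shorter, so the stretch follows by induction on the distance.
   Half of the non-isolated net points at a scale leave the net within
   c = O(1/e^2) further scales, so every point pays for at most c scales: this
   bounds the number of edges by O(m c n) for m partitions per scale, and the
   weight by O(m c t / e) times the sum of the rho_k.  Balls of radius rho_k / 2
   around the first k + 1 points are disjoint, so (k + 1) rho_k is at most twice
   the weight of any spanning tree, and the sum is harmonic. *)

Require Import Defs.
From HB Require Import structures.
From mathcomp Require Import all_boot all_order all_algebra.
From mathcomp Require Import all_classical all_reals all_analysis.
From mathcomp Require Import ring lra.

Set Implicit Arguments.
Unset Strict Implicit.
Unset Printing Implicit Defensive.

Import Order.TTheory GRing.Theory Num.Theory.

Local Open Scope ring_scope.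

(** * Walks as certificates for upper bounds on graph distances *)

Section Walks.
Context {R : realType} {X : finMetricType R}.
Implicit Types (H : {set {set X}}) (x y z : X) (p : seq X) (l : R).

(** A bounded walk avoids the infimum in [graph_dist], and such bounds add up under
    concatenation. *)
Definition linked H l x y : Prop :=
  exists p, [/\ path (adj H) x p, last x p = y & walk_length x p <= l].

Lemma adj_sym H : symmetric (adj H).
Proof. by move=> x y; rewrite /adj finset.setUC. Qed.

Lemma walk_length_cons x y p :
  walk_length x (y :: p) = mdist x y + walk_length y p.
Proof. by rewrite /walk_length /= big_cons. Qed.

Lemma walk_length_cat x p1 p2 :
  walk_length x (p1 ++ p2) = walk_length x p1 + walk_length (last x p1) p2.
Proof. by rewrite /walk_length pairmap_cat big_cat. Qed.

Lemma mdist_walk_length x p : mdist x (last x p) <= walk_length x p.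
Proof.
elim: p x => [|y p IH] x /=; first by rewrite mdistxx /walk_length big_nil.
rewrite walk_length_cons; apply: (le_trans (metric_triangle _ y _)).
by rewrite lerD2l.
Qed.

Lemma linked_refl H l x : 0 <= l -> linked H l x x.
Proof. by move=> l0; exists [::]; rewrite /walk_length big_nil. Qed.

Lemma linked_edge H x y : adj H x y -> linked H (mdist x y) x y.
Proof.
move=> xy; exists [:: y]; split=> //=; first by rewrite xy.
by rewrite walk_length_cons /walk_length big_nil addr0.
Qed.

Lemma linked_trans H l1 l2 y x z :
  linked H l1 x y -> linked H l2 y z -> linked H (l1 + l2) x z.
Proof.
move=> [p [xp <- lp]] [q [yq <- lq]]; exists (p ++ q).
by rewrite cat_path xp last_cat walk_length_cat lerD.
Qed.

Lemma linked_le H l1 l2 x y : l1 <= l2 -> linked H l1 x y -> linked H l2 x y.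
Proof. by move=> l12 [p [xp e lp]]; exists p; split=> //; exact: le_trans l12. Qed.

Lemma linked_sym H l x y : linked H l x y -> linked H l y x.
Proof.
move=> [p [xp <- lp]]; apply: (linked_le lp); elim: p x xp {l lp} => [|z p IH] x /=.
  by move=> _; apply: linked_refl; rewrite /walk_length big_nil.
case/andP=> xz zp; rewrite walk_length_cons addrC metric_sym.
apply: linked_trans (IH _ zp) _.
by apply: linked_edge; rewrite adj_sym.
Qed.

Lemma linked_sub H1 H2 l x y :
  H1 \subset H2 -> linked H1 l x y -> linked H2 l x y.
Proof.
move=> H12 [p [xp e lp]]; exists p; split=> //; apply: sub_path xp => u v.
by rewrite /adj => /(fintype.subsetP H12).
Qed.

(** Only the upper bound has to be supplied: by the triangle inequality a walk is never shorter than
    the distance between its ends. *)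
Lemma spanner_linked (k : R) H :
  is_graph H -> (forall x y, linked H (k * mdist x y) x y) -> spanner k H.
Proof.
move=> gH lH; split=> // x y; split.
  apply: le_ereal_inf_tmp => _ [p [_ <-] <-].
  by rewrite lee_fin mdist_walk_length.
have [p [xp e lp]] := lH x y.
apply: (@le_trans _ _ (walk_length x p)%:E); last by rewrite lee_fin.
by apply: ereal_inf_lbound; exists p.
Qed.

End Walks.

(** * Lower bounds on spanning tree weight by packing *)

Section SpanningTreeWeight.
Context {R : realType} {X : finMetricType R}.
Implicit Types (H : {set {set X}}) (x y z : X).

Lemma diameter_ge0 (C : {set X}) : 0 <= diameter C.
Proof. exact: bigmax_ge_id. Qed.

Lemma mdist_diameter (C : {set X}) x y :
  x \in C -> y \in C -> mdist x y <= diameter C.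
Proof.
move=> xC yC.
apply: (le_trans (le_bigmax_cond 0 (mdist x) yC)).
exact: (le_bigmax_cond 0 (fun x => \big[Num.max/0]_(y in C) mdist x y) xC).
Qed.

(** Edges are unordered sets, so the variation of [f] along an edge is expressed without naming its
    endpoints. *)
Definition oscillation (f : X -> R) (e : {set X}) : R :=
  \big[Num.max/0]_(x in e) \big[Num.max/0]_(y in e) `|f x - f y|.

Lemma oscillation_ge0 f (e : {set X}) : 0 <= oscillation f e.
Proof. exact: bigmax_ge_id. Qed.

Lemma oscillation_ge f (e : {set X}) x y :
  x \in e -> y \in e -> `|f x - f y| <= oscillation f e.
Proof.
move=> xC yC.
apply: (le_trans (le_bigmax_cond 0 (fun y => `|f x - f y|) yC)).
exact: (le_bigmax_cond 0 (fun x => \big[Num.max/0]_(y in e) `|f x - f y|) xC).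
Qed.

Lemma oscillation2 f x y : oscillation f [set x; y]%SET = `|f x - f y|.
Proof.
apply/le_anti/andP; split; last by rewrite oscillation_ge // !inE eqxx ?orbT.
apply: bigmax_le => [|u]; first exact: normr_ge0.
rewrite !inE => /orP[]/eqP->; (apply: bigmax_le => [|v]; first exact: normr_ge0);
  rewrite !inE => /orP[]/eqP->; by rewrite ?subrr ?normr0 ?normr_ge0 // distrC.
Qed.

(** Telescoping. Keeping only the edges inside the vertex set of the walk ensures that the first
    edge, whose start does not recur, is not counted again in the tail. *)
Lemma oscillation_walk f H x (p : seq X) :
  path (adj H) x p -> uniq (x :: p) ->
  `|f x - f (last x p)| <=
    \sum_(e in H | e \subset [set z in x :: p]%SET) oscillation f e.
Proof.
elim: p x => [|y p IH] x /=.
  by move=> _ _; rewrite subrr normr0 sumr_ge0 // => e _; exact: oscillation_ge0.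
case/andP=> xy yp /andP[xNp up].
have eH : [set x; y]%SET \in H := xy.
rewrite (bigD1 [set x; y]%SET) /=; last first.
  rewrite eH /=; apply/fintype.subsetP => z; rewrite !inE.
  by case/orP=> /eqP->; rewrite eqxx ?orbT.
rewrite oscillation2; apply: (le_trans (ler_distD (f y) _ _)).
rewrite lerD2l; apply: (le_trans (IH _ yp up)).
rewrite [leRHS]big_mkcond [leLHS]big_mkcond; apply: ler_sum => e _.
case: ifP => [/andP[eH' esub]|_]; last by case: ifP => // _; exact: oscillation_ge0.
have xNe : x \notin e.
  by apply: contra xNp => /(fintype.subsetP esub); rewrite inE.
rewrite eH' ifT //=; apply/andP; split.
  apply/fintype.subsetP => z /(fintype.subsetP esub).
  by rewrite !inE => ->; rewrite orbT.
by apply: contraNneq xNe => ->; rewrite !inE eqxx.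
Qed.

Lemma oscillation_connect f H x y :
  connect (adj H) x y -> `|f x - f y| <= \sum_(e in H) oscillation f e.
Proof.
case/connectP => p xp ->; case/shortenP: xp => q xq uq _.
apply: (le_trans (oscillation_walk f xq uq)).
rewrite [leRHS]big_mkcond [leLHS]big_mkcond; apply: ler_sum => e _.
by case: (e \in H) => //=; case: ifP => // _; exact: oscillation_ge0.
Qed.

Definition tent (r : R) (s x : X) : R := Num.max 0 (r / 2 - mdist s x).

Lemma tent_eq0 r s x : ~~ (mdist s x < r / 2) -> tent r s x = 0.
Proof. by rewrite -leNgt /tent => h; apply: max_l; rewrite subr_le0. Qed.

Lemma tent_lipschitz r s x y : `|tent r s x - tent r s y| <= mdist x y.
Proof.
have h1 := metric_triangle s x y; have h2 := metric_triangle s y x.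
rewrite (metric_sym y x) in h2; have h3 := mdist_ge0 x y.
rewrite /tent ler_norml; case: (leP 0 (r / 2 - mdist s x)) => ?;
  case: (leP 0 (r / 2 - mdist s y)) => ?; apply/andP; split; lra.
Qed.

(* The tents at r-separated points have disjoint supports, so they vary in
   total no more than a single 1-Lipschitz function. *)
Lemma tent_sum_lipschitz (S : {set X}) r x y :
  (forall s s', s \in S -> s' \in S -> s != s' -> r <= mdist s s') ->
  \sum_(s in S) `|tent r s x - tent r s y| <= mdist x y.
Proof.
move=> sep.
have uniq_tent z s s' : s \in S -> s' \in S -> s != s' -> mdist s z < r / 2 ->
    tent r s' z = 0.
  move=> sS s'S ss' sz; apply: tent_eq0; apply/negP => s'z.
  have := sep _ _ sS s'S ss'; have := metric_triangle s z s'.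
  rewrite (metric_sym z); lra.
(* At most one tent is nonzero at [x] and at most one at [y]; the cases record which exist and
   whether they coincide. *)
case: (pickP [pred s in S | mdist s x < r / 2]) => [s1 /andP[s1S s1x]|nox]; last first.
  have {}nox s : s \in S -> tent r s x = 0.
    by move=> sS; apply: tent_eq0; have /= := nox s; rewrite sS /= => ->.
  case: (pickP [pred s in S | mdist s y < r / 2]) => [s2 /andP[s2S s2y]|noy].
    rewrite (bigD1 s2) //= big1 ?addr0 ?tent_lipschitz // => s /andP[sS ss2].
    by rewrite nox // (uniq_tent _ s2) // 1?eq_sym // subrr normr0.
  rewrite big1 ?mdist_ge0 // => s sS; rewrite nox // tent_eq0 ?subrr ?normr0 //.
  by have /= := noy s; rewrite sS /= => ->.
rewrite (bigD1 s1) //=.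
case: (pickP [pred s in S | (s != s1) && (mdist s y < r / 2)])
    => [s2 /and3P[s2S s21 s2y]|noy].
  rewrite (bigD1 s2) ?s2S //= big1 ?addr0; last first.
    move=> s /andP[/andP[sS ss1] ss2].
    by rewrite (uniq_tent _ s1) // 1?eq_sym // (uniq_tent _ s2) // 1?eq_sym // subrr normr0.
  (* Two different tents contribute [r - mdist s1 x - mdist s2 y] in total, at most [mdist x y]
     because [r <= mdist s2 s1]. *)
  rewrite (uniq_tent y s2 s1) // (uniq_tent x s1 s2) // 1?eq_sym //.
  rewrite subr0 sub0r normrN !ger0_norm ?le_max ?lexx //.
  rewrite /tent !max_r ?subr_ge0 ?(ltW s1x) ?(ltW s2y) //.
  have := sep _ _ s2S s1S s21; have := metric_triangle s2 y s1.
  have := metric_triangle y x s1.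
  rewrite (metric_sym y x) (metric_sym x s1). lra.
rewrite big1 ?addr0 ?tent_lipschitz // => s /andP[sS ss1].
rewrite (uniq_tent _ s1) // 1?eq_sym // tent_eq0 ?subrr ?normr0 //.
by have /= := noy s; rewrite sS ss1 /= => ->.
Qed.

(** Each tent falls from [r / 2] at its center to 0 at another point of [S], so its oscillations
    over the edges of a connected graph total at least [r / 2]. Together the tents charge each edge
    at most its length. *)
Lemma packing_weight H (S : {set X}) (r : R) :
  is_graph H -> (forall x y, connect (adj H) x y) -> (1 < #|S|)%N -> 0 <= r ->
  (forall s s', s \in S -> s' \in S -> s != s' -> r <= mdist s s') ->
  #|S|%:R * (r / 2) <= weight H.
Proof.
move=> gH cH S2 r0 sep.
have tent_osc s : s \in S -> r / 2 <= \sum_(e in H) oscillation (tent r s) e.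
  move=> sS; have /card_gt0P[s'] : (0 < #|S :\ s|)%N.
    by move: S2; rewrite (cardsD1 s) sS.
  rewrite !inE => /andP[s's s'S].
  apply: le_trans (oscillation_connect (tent r s) (cH s s')).
  have := sep _ _ sS s'S; rewrite eq_sym => /(_ s's) rs'.
  rewrite (@tent_eq0 r s s'); last by rewrite -leNgt; lra.
  by rewrite /tent mdistxx !subr0 max_r ?ler_norm //; lra.
rewrite mulr_natl -sumr_const.
apply: (@le_trans _ _ (\sum_(s in S) \sum_(e in H) oscillation (tent r s) e)).
  exact: ler_sum.
rewrite exchange_big /=.
apply: ler_sum => e eH.
have /cards2P[x [y [xy ->]]] : #|e| == 2%N by rewrite gH.
rewrite edge_weightE; under eq_bigr do rewrite oscillation2.
exact: tent_sum_lipschitz.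
Qed.

(** Shows that the infimum defining [mst_weight] ranges over a nonempty set, so that lower bounds on
    tree weights pass to it. *)
Lemma star_spanning_tree (c : X) :
  spanning_tree [set [set c; x]%SET | x in [set~ c]%SET].
Proof.
set H := imset _ _.
have adjH x y : adj H x y = (x != y) && ((x == c) || (y == c)).
  apply/imsetP/idP => [[z]|].
    rewrite !inE => zc /setP e; have := e c; have := e x; have := e y; have := e z.
    rewrite !inE !eqxx ?orbT /= => ez ey ex ec; rewrite eq_sym in zc.
    have {}ec : (x == c) || (y == c) by rewrite eq_sym [y == c]eq_sym.
    rewrite ec andbT; apply/negP => /eqP xy; subst y.
    rewrite orbb in ec; rewrite orbb eq_sym (eqP ec) in ez.
    by rewrite (eqP ez) eqxx in zc.
  case/andP=> xy /orP[]/eqP e; subst c.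
    by exists y => //; rewrite !inE eq_sym.
  by exists x; [rewrite !inE | rewrite finset.setUC].
split.
- by move=> e /imsetP[x]; rewrite !inE => xc ->; rewrite cards2 eq_sym xc.
- have cc x : connect (adj H) x c.
    have [->|xc] := eqVneq x c; first exact: connect0.
    by apply: connect1; rewrite adjH xc eqxx orbT.
  move=> x y; apply: connect_trans (cc x) _.
  by rewrite (sym_connect_sym (@adj_sym _ _ H)).
(* In a cycle [x, y, z, ...] both edges at [y] contain [c]; as [x] and [z] differ, [y] is [c], and
   then the closing edge back to [x] misses [c]. *)
move=> [|x [|y [|z s]]] // _ /andP[] /=.
rewrite !adjH rcons_path adjH => /and4P[/andP[xy xyc] /andP[yz yzc] _ /andP[lx lc]].
rewrite !inE !negb_or -!andbA => /and5P[_ xz xs yz' /andP[ys zs]].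
have lxyz : last z s \in z :: s := mem_last z s.
case: (eqVneq y c) => [e|yc]; subst.
  move: lc; rewrite (negPf xy) orbF => /eqP e.
  by move: lxyz; rewrite e inE (negPf ys) orbF (negPf yz').
move: xyc yzc; rewrite (negPf yc) orbF /= => /eqP e1 /eqP e2; subst.
by rewrite eqxx in xz.
Qed.

Lemma packing_mst (S : {set X}) (r : R) :
  (1 < #|S|)%N -> 0 <= r ->
  (forall s s', s \in S -> s' \in S -> s != s' -> r <= mdist s s') ->
  #|S|%:R * (r / 2) <= @mst_weight R X.
Proof.
move=> S2 r0 sep.
have /card_gt0P[c _] : (0 < #|S|)%N by exact: leq_trans S2.
apply: lb_le_inf.
  by exists (weight [set [set c; x]%SET | x in [set~ c]%SET]);
    eexists; first exact: star_spanning_tree.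
by move=> _ [H [gH cH _] <-]; exact: packing_weight.
Qed.

End SpanningTreeWeight.

(** * Stars inside the clusters of a partition *)

Section Stars.
Context {R : realType} {X : finMetricType R}.
Implicit Types (V : {set X}) (P : {set {set X}}) (u v : X).

(** The choice depends only on the cluster of [v], so the points of [V] in one cluster share it; the
    default serves clusters that miss [V]. *)
Definition center P V v : X := odflt v [pick u in (V :&: finset.pblock P v)%SET].

Definition star_edges P V : {set {set X}} :=
  [set [set v; center P V v]%SET | v in V & v != center P V v].

Lemma center_pblock P V v :
  finset.partition P [set: X] -> center P V v \in finset.pblock P v.
Proof.
move=> partP; rewrite /center; case: pickP => [u|_] /=.
  by rewrite inE => /andP[].
by rewrite finset.mem_pblock (finset.cover_partition partP) inE.
Qed.

Lemma same_cluster_pblock P u v :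
  finset.partition P [set: X] -> same_cluster P u v -> finset.pblock P u = finset.pblock P v.
Proof.
move=> /and3P[_ trivP _] /existsP[C /and3P[CP uC vC]].
by rewrite !(finset.def_pblock trivP CP).
Qed.

Lemma same_cluster_center P V u v :
  finset.partition P [set: X] -> u \in V -> same_cluster P u v ->
  center P V u = center P V v.
Proof.
move=> partP uV uv; rewrite /center -(same_cluster_pblock partP uv).
case: pickP => //= /(_ u).
by rewrite inE uV finset.mem_pblock (finset.cover_partition partP) inE.
Qed.

Lemma star_graph P V : is_graph (star_edges P V).
Proof.
move=> e /imsetP[v]; rewrite inE => /andP[_ vc] ->.
by rewrite cards2 vc.
Qed.

Lemma card_star P V : (#|star_edges P V| <= #|V|)%N.
Proof.
apply: leq_trans (leq_imset_card _ _) _; apply: subset_leq_card.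
by apply/fintype.subsetP => v; rewrite inE => /andP[].
Qed.

Lemma mdist_center P V (D : R) v :
  finset.partition P [set: X] -> (forall C, C \in P -> diameter C <= D) ->
  mdist v (center P V v) <= D.
Proof.
move=> partP diamP; have vP : v \in finset.cover P by rewrite (finset.cover_partition partP) inE.
apply: le_trans (diamP _ (finset.pblock_mem vP)).
by rewrite mdist_diameter ?center_pblock // finset.mem_pblock.
Qed.

Lemma star_diameter P V (D : R) e :
  finset.partition P [set: X] -> (forall C, C \in P -> diameter C <= D) ->
  e \in star_edges P V -> diameter e <= D.
Proof.
move=> partP diamP /imsetP[v _ ->].
by rewrite edge_weightE mdist_center.
Qed.

Lemma linked_center P V (D : R) v :
  finset.partition P [set: X] -> (forall C, C \in P -> diameter C <= D) ->
  v \in V -> linked (star_edges P V) D v (center P V v).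
Proof.
move=> partP diamP vV; have vD := mdist_center V v partP diamP.
have [<-|vc] := eqVneq v (center P V v).
  by apply: linked_refl; apply: le_trans vD; exact: mdist_ge0.
apply: (linked_le vD); apply: linked_edge.
by apply/imsetP; exists v; rewrite // inE vV.
Qed.

(** The route through the common center has at most two edges, each bounded by the cluster diameter:
    this is the factor 2 of the stretch. *)
Lemma star_linked P V (D : R) u v :
  finset.partition P [set: X] -> (forall C, C \in P -> diameter C <= D) ->
  u \in V -> v \in V -> same_cluster P u v ->
  linked (star_edges P V) (D + D) u v.
Proof.
move=> partP diamP uV vV uv.
apply: linked_trans (linked_center partP diamP uV) _.
rewrite (same_cluster_center partP uV uv).
exact/linked_sym/linked_center.
Qed.

End Stars.

(** * Covering all close pairs by few partitions *)

Section Covering.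
Context {R : realType} {X : finMetricType R}.
Context (t Delta delta : R) (mu : {ffun {set {set X}} -> R}).
Context (mu_dec : decomposition t Delta delta mu).
Implicit Types (P : {set {set X}}) (s : seq {set {set X}}).

(** By exchanging sums, the expected number of pairs of [U] kept together is at least
    [delta * #|U|]; the best partition of the support reaches this mean. *)
Lemma decomposition_hit (U : {set X * X}) :
  (forall p, p \in U -> mdist p.1 p.2 <= Delta) ->
  exists2 P, mu P != 0 &
    delta * #|U|%:R <= #|[set p in U | same_cluster P p.1 p.2]|%:R.
Proof.
move=> UD; case: mu_dec => -[mu0 mu1] _ _ muD.
pose hit P := [set p in U | same_cluster P p.1 p.2].
case: (pickP [pred P | mu P != 0]) => [P1 muP1|mu_eq0]; last first.
  move/eqP: mu1; rewrite big1 ?[_ == 1]eq_sym ?oner_eq0 // => P _.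
  by apply/eqP; have /= := mu_eq0 P; case: eqP.
case: (arg_maxnP (fun P => #|hit P|) (muP1 : (fun P => mu P != 0) P1)) => P muP maxP.
exists P => //.
have -> : #|hit P|%:R = \sum_Q mu Q * #|hit P|%:R by rewrite -mulr_suml mu1 mul1r.
apply: (@le_trans _ _ (\sum_Q mu Q * #|hit Q|%:R)); last first.
  apply: ler_sum => Q _; have [->|muQ] := eqVneq (mu Q) 0; first by rewrite !mul0r.
  by rewrite ler_wpM2l // ler_nat; exact: maxP.
have -> : \sum_Q mu Q * #|hit Q|%:R =
    \sum_(p in U) \sum_(Q | same_cluster Q p.1 p.2) mu Q.
  under eq_bigr => Q _.
    rewrite -sum1_card natr_sum mulr_sumr.
    under eq_bigl do rewrite inE.
    rewrite big_mkcondr.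
    over.
  rewrite exchange_big /=; apply: eq_bigr => p _.
  by rewrite -big_mkcond; apply: eq_bigr => Q _; rewrite mulr1.
rewrite mulr_natr -sumr_const; apply: ler_sum => p pU.
exact/muD/UD.
Qed.

Definition uncovered s : {set X * X} :=
  [set p | (mdist p.1 p.2 <= Delta) && ~~ has (fun P => same_cluster P p.1 p.2) s].

(** Each further partition is chosen for the pairs still uncovered and removes a [delta] fraction of
    them. *)
Lemma decomposition_cover (m : nat) : 0 <= delta -> delta <= 1 ->
  exists s, [/\ size s = m, forall P, P \in s -> mu P != 0
    & #|uncovered s|%:R <= (1 - delta) ^+ m * (#|X| ^ 2)%:R].
Proof.
move=> d0 d1; elim: m => [|m [s [<- sP cov]]].
  exists [::]; split=> //; rewrite expr0 mul1r ler_nat -mulnn -card_prod.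
  exact: max_card.
have [|P muP hitP] := @decomposition_hit (uncovered s).
  by move=> p; rewrite inE => /andP[].
exists (P :: s); split=> //.
  by move=> Q; rewrite inE => /orP[/eqP->|/sP].
rewrite exprS -mulrA.
apply: le_trans (ler_wpM2l _ cov); last by rewrite subr_ge0.
rewrite mulrBl mul1r lerBrDr.
apply: le_trans (lerD (lexx _) hitP) _.
rewrite -natrD ler_nat -[leqRHS](cardsID [set p | same_cluster P p.1 p.2]) addnC.
rewrite leq_add // subset_leq_card //; apply/fintype.subsetP => p; rewrite !inE //=.
by rewrite negb_or => /and3P[-> -> ->].
Qed.

Lemma spanner_scale (m : nat) (V : {set X}) : 0 <= delta -> delta <= 1 ->
  (1 - delta) ^+ m * (#|X| ^ 2)%:R < 1 ->
  exists E : {set {set X}}, [/\ is_graph E, (#|E| <= m * #|V|)%N,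
    forall e, e \in E -> diameter e <= t * Delta
  & forall u v, u \in V -> v \in V -> mdist u v <= Delta ->
      linked E (t * Delta + t * Delta) u v].
Proof.
move=> d0 d1 m1; have [s [sm sP cov]] := decomposition_cover m d0 d1.
(* A cardinality below 1 is 0. *)
have uncov0 : uncovered s = finset.set0.
  apply/eqP; rewrite -cards_eq0 -leqn0 -ltnS -(ltr_nat R).
  exact: le_lt_trans cov m1.
case: mu_dec => _ mu_part mu_diam _.
exists (\bigcup_(P <- s) star_edges P V)%SET; split.
- rewrite finset.bigcup_seq => e /finset.bigcupP[P _]; exact: star_graph.
- apply: (@leq_trans (\sum_(P <- s) #|V|)); last first.
    by rewrite big_const_seq count_predT sm iter_addn_0 mulnC.
  apply: leq_trans (unstable.card_big_setU _ _ _) _.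
  by apply: leq_sum => P _; exact: card_star.
- rewrite finset.bigcup_seq => e /finset.bigcupP[P /sP muP].
  by apply: star_diameter; [exact: mu_part | exact: mu_diam].
move=> u v uV vV uv.
have /hasP[P Ps uvP] : has (fun P => same_cluster P u v) s.
  apply/negPn/negP => nuv; have : (u, v) \in uncovered s by rewrite inE uv.
  by rewrite uncov0 inE.
apply: linked_sub (star_linked _ _ uV vV uvP).
- by rewrite finset.bigcup_seq (finset.bigcup_sup P).
- exact/mu_part/sP.
- exact/mu_diam/sP.
Qed.

End Covering.

(** * Elementary counting and numerical estimates *)

Section Counting.

Lemma card_window (M c : nat) (P : pred nat) :
  (forall i j, (i <= j)%N -> P i -> P j -> (j < i + c)%N) ->
  (#|[pred i : 'I_M | P i]| <= c)%N.
Proof.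
move=> Pc; case: (pickP [pred i : 'I_M | P i]) => [i1 Pi1|P0]; last by rewrite eq_card0.
case: (arg_minnP (fun i : 'I_M => i : nat) Pi1) => i0 Pi0 mini0.
rewrite cardE -(size_map val) -(size_iota i0 c); apply: uniq_leq_size.
  by rewrite (map_inj_uniq val_inj) enum_uniq.
move=> k /mapP[i]; rewrite mem_enum inE => Pi ->.
by rewrite mem_iota mini0 //= Pc // mini0.
Qed.

Lemma harmonic_le_ln {R : realType} (n : nat) : (0 < n)%N ->
  \sum_(k < n) (k.+1%:R : R)^-1 <= 1 + ln n%:R.
Proof.
case: n => // n _; elim: n => [|n IH].
  by rewrite big_ord_recl big_ord0 invr1 ln1.
rewrite big_ord_recr /=; apply: le_trans (lerD IH (lexx _)) _.
rewrite -addrA lerD2l -lerBrDl.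
have n0 : (0 : R) < n.+1%:R by [].
have n1 : (0 : R) < n.+2%:R by [].
(* What remains is [ln (1 + a) <= a] at [a = - 1 / (n + 2)], after inverting the quotient. *)
rewrite -ln_div ?posrE // -[leLHS]opprK lerNl -lnV ?posrE ?divr_gt0 // invf_div.
have -> : n.+1%:R / n.+2%:R = 1 + - (n.+2%:R)^-1 :> R.
  apply: (mulIf (lt0r_neq0 n1)); rewrite divfK ?lt0r_neq0 //.
  by rewrite mulrDl mul1r mulNr mulVf ?lt0r_neq0 // -[n.+2%:R]natr1 addrK.
by apply: le_ln1Dx; rewrite ltrN2 invf_lt1 // ltr1n.
Qed.

(** Bernoulli's inequality. *)
Lemma exprn_ge1Dn {R : realDomainType} (a : R) (n : nat) :
  0 <= a -> 1 + n%:R * a <= (1 + a) ^+ n.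
Proof.
move=> a0; elim: n => [|n IH]; first by rewrite mul0r addr0.
rewrite exprS; apply: (@le_trans _ _ ((1 + a) * (1 + n%:R * a))).
  rewrite -natr1; have : 0 <= n%:R * a * a by rewrite !mulr_ge0.
  lra.
by rewrite ler_wpM2l // addr_ge0.
Qed.

End Counting.

(** * Nested nets from a farthest-point ordering *)

Section Nets.
Context {R : realType} {X : finMetricType R}.

(* Of two close points of N at most one survives in the 2D-separated set N',
   so at least half of the non-isolated points of N are lost in N'. *)
Lemma card_nonisolated (N N' : {set X}) (D : R) :
  0 <= D ->
  (forall x y, x \in N' -> y \in N' -> x != y -> 2 * D < mdist x y) ->
  (#|[set x in N | [exists y in N, (x != y) && (mdist x y <= D)%R]]| <=
    2 * #|N :\: N'|)%N.
Proof.
move=> D0 sep; set A := [set x in N | _].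
pose f x := odflt x [pick y in N | (x != y) && (mdist x y <= D)].
have fP x : x \in A -> [/\ f x \in N, x != f x & mdist x (f x) <= D].
  rewrite inE => /andP[_ /existsP[y yP]]; rewrite /f.
  by case: pickP => [z /and3P[]|/(_ y)] //=; rewrite yP.
(* Points of [A] outside [N'] are themselves lost. Those in [N'] are sent by [f] to lost neighbours,
   injectively, since two with a common neighbour would be within [2 * D]. *)
rewrite -(cardsID N' A) mul2n -addnn leq_add //; last first.
  apply: subset_leq_card; apply: finset.setSD.
  by apply/fintype.subsetP => x; rewrite inE => /andP[].
rewrite -(card_in_imset (f := f)).
  apply: subset_leq_card; apply/fintype.subsetP => _ /imsetP[x xAN ->].
  move: xAN; rewrite finset.in_setI => /andP[/fP[fN xf xfD] xN'].
  rewrite finset.in_setD fN andbT; apply/negP => fN'.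
  by have := sep _ _ xN' fN' xf; lra.
move=> x y; rewrite !finset.in_setI => /andP[/fP[_ _ xf] xN'] /andP[/fP[_ _ yf] yN'] e.
apply/eqP/negPn/negP => /(sep _ _ xN' yN').
have := metric_triangle x (f x) y; rewrite (metric_sym (f x) y) {2}e; lra.
Qed.

Context (x0 : X).

(* The default value makes the first insertion radius the diameter. *)
Definition seq_dist (s : seq X) (y : X) : R :=
  \big[Num.min/diameter [set: X]]_(z <- s) mdist y z.

Definition farthest (s : seq X) : X := [arg max_(y > x0) seq_dist s y]%O.

(** Latest point first. The sequence never stops: once [X] is exhausted, points repeat with
    insertion radius 0. *)
Fixpoint greedy_seq (k : nat) : seq X :=
  if k is k'.+1 then farthest (greedy_seq k') :: greedy_seq k' else [::].

Definition greedy (k : nat) : X := farthest (greedy_seq k).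

Definition insertion_radius (k : nat) : R := seq_dist (greedy_seq k) (greedy k).

Lemma seq_dist_cons z s y :
  seq_dist (z :: s) y = Num.min (mdist y z) (seq_dist s y).
Proof. by rewrite /seq_dist big_cons. Qed.

Lemma radius_ge0 k : 0 <= insertion_radius k.
Proof.
rewrite /insertion_radius /seq_dist; elim/big_ind: _ => [|a b a0 b0|z _].
- exact: diameter_ge0.
- by rewrite le_min a0.
- exact: mdist_ge0.
Qed.

Lemma seq_dist_radius k y : seq_dist (greedy_seq k) y <= insertion_radius k.
Proof. by rewrite /insertion_radius /greedy /farthest; case: arg_maxP => // z _; exact. Qed.

Lemma radius0 : insertion_radius 0 = diameter [set: X].
Proof. by rewrite /insertion_radius /seq_dist big_nil. Qed.

Lemma radius_le j k : (j <= k)%N -> insertion_radius k <= insertion_radius j.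
Proof.
elim: k => [|k IH]; first by rewrite leqn0 => /eqP->.
rewrite leq_eqVlt => /orP[/eqP->//|]; rewrite ltnS => /IH.
apply: le_trans; rewrite {1}/insertion_radius /= seq_dist_cons ge_min.
by rewrite seq_dist_radius orbT.
Qed.

Lemma mem_greedy_seq k z :
  z \in greedy_seq k -> exists2 j, (j < k)%N & z = greedy j.
Proof.
elim: k => //= k IH; rewrite inE => /orP[/eqP->|/IH[j jk ->]]; first by exists k.
by exists j => //; exact: ltnW.
Qed.

Lemma greedy_seq_mem j k : (j < k)%N -> greedy j \in greedy_seq k.
Proof.
elim: k => //= k IH; rewrite ltnS leq_eqVlt inE => /orP[/eqP->|/IH->].
  by rewrite eqxx.
by rewrite orbT.
Qed.

Lemma radius_sep j k : (j < k)%N -> insertion_radius k <= mdist (greedy k) (greedy j).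
Proof.
move=> /greedy_seq_mem jk; rewrite /insertion_radius; move: (greedy k) => y.
elim: (greedy_seq k) jk => // z s IH; rewrite inE seq_dist_cons ge_min.
by case/orP=> [/eqP->|/IH->]; rewrite ?lexx ?orbT.
Qed.

Lemma greedy_sep (m j k : nat) :
  (j <= m)%N -> (k <= m)%N -> j != k -> insertion_radius m <= mdist (greedy j) (greedy k).
Proof.
wlog jk : j k / (j < k)%N.
  move=> th jm km; rewrite neq_ltn => /orP[] h; first by apply: th; rewrite // ltn_eqF.
  by rewrite metric_sym; apply: th; rewrite // ltn_eqF.
move=> _ km _; rewrite metric_sym.
exact: le_trans (radius_le km) (radius_sep jk).
Qed.

Lemma greedy_inj (m : nat) : 0 < insertion_radius m ->
  injective (fun k : 'I_m.+1 => greedy k).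
Proof.
move=> m0 j k /= e; apply/val_inj/eqP/negPn/negP => jk.
have := greedy_sep (leq_ord j) (leq_ord k) jk.
by rewrite e mdistxx leNgt m0.
Qed.

(** A positive radius at this index would give [#|X| + 1] distinct points. *)
Lemma radius_card : insertion_radius #|X| <= 0.
Proof.
rewrite leNgt; apply/negP => /greedy_inj/leq_card.
by rewrite card_ord ltnn.
Qed.

(** The bound on [r] rules out that the minimum is the default value. *)
Lemma seq_dist_witness (s : seq X) y (r : R) :
  r < diameter [set: X] -> seq_dist s y <= r -> exists2 z, z \in s & mdist y z <= r.
Proof.
move=> rD; elim: s => [|z s IH].
  by rewrite /seq_dist big_nil leNgt rD.
rewrite seq_dist_cons ge_min => /orP[yz|/IH[w ws yw]].
  by exists z; rewrite // inE eqxx.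
by exists w; rewrite // inE ws orbT.
Qed.

Definition net (r : R) : {set X} :=
  [set greedy k | k : 'I_#|X| in [pred k : 'I_#|X| | r < insertion_radius k]]%SET.

Lemma net_cover (r : R) y : 0 <= r -> r < diameter [set: X] ->
  exists2 z, z \in net r & mdist y z <= r.
Proof.
move=> r0 rD; have exK : exists k, insertion_radius k <= r.
  by exists #|X|; exact: le_trans radius_card r0.
(* By minimality of [K], the first [K] greedy points all belong to the net. *)
case: (ex_minnP exK) => K Kr minK.
have [z /mem_greedy_seq[j jK ->] yz] := seq_dist_witness rD (le_trans (seq_dist_radius K y) Kr).
have KX : (K <= #|X|)%N by apply: minK; exact: le_trans radius_card r0.
exists (greedy j) => //.
apply/imsetP; exists (Ordinal (leq_trans jK KX)) => //.
by rewrite inE /= ltNge; apply/negP => /minK; rewrite leqNgt jK.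
Qed.

Lemma net_sep (r : R) x y :
  x \in net r -> y \in net r -> x != y -> r < mdist x y.
Proof.
case/imsetP=> j; rewrite inE => rj ->; case/imsetP=> k; rewrite inE => rk -> jk.
have {jk}jk : (j : nat) != k by apply: contraNneq jk => ->.
apply: lt_le_trans (greedy_sep (leq_maxl j k) (leq_maxr j k) jk).
by case/orP: (leq_total j k) => h; [rewrite (maxn_idPr h)|rewrite (maxn_idPl h)].
Qed.

(** A sum of indicators over insertion indices can later be exchanged with the sum over scales. *)
Lemma card_netD (r r' : R) :
  (#|net r :\: net r'| <=
    \sum_(k < #|X|) ((r < insertion_radius k) && (insertion_radius k <= r'))%R)%N.
Proof.
rewrite -big_mkcond sum1_card.
apply: leq_trans (leq_imset_card (fun k : 'I_#|X| => greedy k) _).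
apply: subset_leq_card; apply/fintype.subsetP => x.
rewrite finset.in_setD => /andP[xNr' /imsetP[k kr ex]]; subst x.
apply/imsetP; exists k => //; rewrite inE in kr.
rewrite unfold_in /= kr /= leNgt; apply: contra xNr' => r'k.
by apply/imsetP; exists k; rewrite // inE.
Qed.

Lemma mst_weight_ge0 : (1 < #|X|)%N -> 0 <= @mst_weight R X.
Proof.
move=> X2; have := @packing_mst R X [set: X] 0; rewrite cardsT mul0r mulr0.
by apply=> // x y _ _ _; exact: mdist_ge0.
Qed.

Lemma diameter_mst_weight : (1 < #|X|)%N -> diameter [set: X] <= @mst_weight R X.
Proof.
move=> X2; have mst0 := mst_weight_ge0 X2.
apply: bigmax_le => // x _; apply: bigmax_le => // y _.
have [->|xy] := eqVneq x y; first by rewrite mdistxx.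
have := @packing_mst R X [set x; y]%SET (mdist x y); rewrite cards2 xy.
rewrite mulrC divfK ?pnatr_eq0 //; apply => //; first exact: mdist_ge0.
move=> s s'; rewrite !inE => /orP[]/eqP-> /orP[]/eqP->; rewrite ?eqxx // => _.
by rewrite metric_sym.
Qed.

Lemma radius_mst_weight k : (1 < #|X|)%N ->
  k.+1%:R * insertion_radius k <= 2 * @mst_weight R X.
Proof.
move=> X2; have mst0 := mst_weight_ge0 X2.
(* Packing needs two points, so the first radius is handled through the diameter. *)
case: k => [|k]; first by rewrite mul1r radius0; have := diameter_mst_weight X2; lra.
have [k0|k0] := leP (insertion_radius k.+1) 0.
  apply: (@le_trans _ _ 0); last by rewrite mulr_ge0.
  by rewrite mulr_ge0_le0.
have := @packing_mst R X [set greedy i | i : 'I_k.+2]%SET (insertion_radius k.+1).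
rewrite card_imset ?card_ord; last exact: greedy_inj.
rewrite mulrA ler_pdivrMr // [mst_weight * 2]mulrC; apply => //; first exact: ltW.
move=> _ _ /imsetP[i _ ->] /imsetP[j _ ->] ij.
apply: (greedy_sep (leq_ord i) (leq_ord j)).
by apply: contraNneq ij => ->.
Qed.

Lemma radius_sum : (1 < #|X|)%N ->
  \sum_(k < #|X|) insertion_radius k <= 2 * @mst_weight R X * (1 + ln #|X|%:R).
Proof.
move=> X2; have mst0 := mst_weight_ge0 X2.
apply: (@le_trans _ _ (\sum_(k < #|X|) 2 * @mst_weight R X * k.+1%:R^-1)).
  by apply: ler_sum => k _; rewrite ler_pdivlMr // mulrC radius_mst_weight.
rewrite -mulr_sumr ler_wpM2l ?mulr_ge0 //.
by apply: harmonic_le_ln; exact: ltnW.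
Qed.

End Nets.

(** * Inequalities between the constants *)

Lemma shift_constant {R : realFieldType} (e a : R) :
  0 < e -> e <= 1 / 128 -> 3 <= a * e ^+ 2 -> 2 * (1 + 2 * e) <= e * (1 + a * e).
Proof. by rewrite expr2; lra. Qed.

(** Makes the detours of a pair strictly shorter than the pair itself. *)
Lemma small_constant {R : realFieldType} (e : R) :
  0 < e -> e <= 1 / 128 -> e * (1 + e) < 1.
Proof.
move=> e0 e1; have e2 : e * e <= e * (1 / 128) by rewrite ler_pM2l.
lra.
Qed.

(** Two detours and the middle hop total [t * s * (2 + 8 * e + 32 * e ^+ 2)]; the slack in [16 * e]
    absorbs this and the rounding of [d] up to [s]. *)
Lemma stretch_constant {R : realFieldType} (t d s e : R) :
  0 < t -> 0 < d -> 0 < e -> e <= 1 / 128 -> s <= (1 + e) * d ->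
  t * (2 + 16 * e) * (e * s) + (t * ((1 + 2 * e) * s) + t * ((1 + 2 * e) * s)) +
    t * (2 + 16 * e) * (e * s) <= t * (2 + 16 * e) * d.
Proof.
move=> t0 d0 e0 e1 sd.
have ts : t * s * (2 + 8 * e + 32 * e ^+ 2) <=
    t * ((1 + e) * d) * (2 + 8 * e + 32 * e ^+ 2).
  apply: ler_wpM2r; last exact: ler_wpM2l (ltW t0) _ _ sd.
  by rewrite ltW // !addr_gt0 ?mulr_gt0 // exprn_gt0.
have td : t * d * ((1 + e) * (2 + 8 * e + 32 * e ^+ 2)) <= t * d * (2 + 16 * e).
  rewrite ler_pM2l ?mulr_gt0 //.
  have e2 : e * e <= e * (1 / 128) by rewrite ler_pM2l.
  have e3 : e * (e * e) <= e * (e * (1 / 128)) by rewrite ler_pM2l.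
  by rewrite expr2; lra.
lra.
Qed.

(** * The union of the star graphs over all scales *)

Section LightSpanner.
Context {R : realType} {X : finMetricType R}.

Lemma weight_setU (A B : {set {set X}}) :
  weight (A :|: B)%SET <= weight A + weight B.
Proof.
rewrite /weight big_mkcond [leRHS]addrC [\sum_(e in A) _]big_mkcond.
rewrite [\sum_(e in B) _]big_mkcond -big_split /=; apply: ler_sum => e _.
by rewrite inE; case: (e \in A); case: (e \in B) => //=;
  rewrite ?addr0 ?add0r // lerDl diameter_ge0.
Qed.

Lemma weight_bigcup (I : finType) (E : I -> {set {set X}}) :
  weight (\bigcup_i E i)%SET <= \sum_i weight (E i).
Proof.
elim/big_ind2 : _ => [|A a B b Aa Bb|//]; first by rewrite /weight big_set0.
exact: le_trans (weight_setU _ _) (lerD Aa Bb).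
Qed.

Context (x0 : X) (t delta e d0 : R) (m c M : nat).
Context (t1 : 1 <= t) (delta0 : 0 <= delta) (delta1 : delta <= 1).
Context (e0 : 0 < e) (e1 : e <= 1 / 128).
Context (d0_gt0 : 0 < d0) (d0_min : forall x y : X, x != y -> d0 <= mdist x y).
Context (M_large : diameter [set: X] <= d0 * (1 + e) ^+ M).
Context (c_large : 3 <= c%:R * e ^+ 2).
Context (m_large : (1 - delta) ^+ m * (#|X| ^ 2)%:R < 1).
Context (Xdec : decomposable X t delta).

Definition scale (i : nat) : R := d0 * (1 + e) ^+ i.

Lemma scale_gt0 i : 0 < scale i.
Proof. by rewrite mulr_gt0 // exprn_gt0 // addr_gt0. Qed.

Lemma scale_le i j : (i <= j)%N -> scale i <= scale j.
Proof. by move=> ij; rewrite ler_pM2l // ler_weXn2l // lerDl ltW. Qed.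

(** Take the least scale reaching the distance: the previous scale falls short of it, and at index 0
    [d0_min] gives the upper bound. *)
Lemma scale_approx (x y : X) : x != y ->
  exists2 i, (i <= M)%N & mdist x y <= scale i <= (1 + e) * mdist x y.
Proof.
move=> xy; have exi : exists i, mdist x y <= scale i.
  by exists M; apply: le_trans M_large; rewrite mdist_diameter ?inE.
case: (ex_minnP exi) => i di mini; exists i.
  by apply: mini; apply: le_trans M_large; rewrite mdist_diameter ?inE.
rewrite di; case: i di mini => [_ _|i _ mini].
  rewrite /scale mulr1; apply: le_trans (d0_min xy) _.
  by rewrite ler_peMl ?mdist_ge0 // lerDl ltW.
rewrite /scale exprS mulrCA ler_pM2l ?addr_gt0 //.
by apply/ltW; rewrite ltNge; apply/negP => /mini; rewrite ltnn.
Qed.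

(** The separation of the net [c] scales later is twice the closeness radius at scale [i], as
    [card_nonisolated] requires. *)
Lemma scale_shift i : 2 * ((1 + 2 * e) * scale i) <= e * scale (i + c).
Proof.
have h := exprn_ge1Dn c (ltW e0); have s0 := scale_gt0 i.
have -> : scale (i + c) = (1 + e) ^+ c * scale i.
  by rewrite /scale exprD; ring.
rewrite [leLHS]mulrA [leRHS]mulrA ler_pM2r //.
apply: (@le_trans _ _ (e * (1 + c%:R * e))); last first.
  by rewrite ler_pM2l.
exact: shift_constant.
Qed.

(** Bounds the distance of the net points of a pair at distance at most [scale i]: the pair plus two
    detours of [e * scale i]. *)
Definition close_radius i : R := (1 + 2 * e) * scale i.

Lemma close_radius_gt0 i : 0 < close_radius i.
Proof. by rewrite mulr_gt0 ?scale_gt0 // addr_gt0 // mulr_gt0. Qed.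

(** Dropping isolated net points is what keeps the totals independent of the number of scales. *)
Definition active (i : nat) : {set X} :=
  [set x in net x0 (e * scale i) | [exists y in net x0 (e * scale i),
     (x != y) && (mdist x y <= close_radius i)]].

(* The k-th point is in the net of scale i but not in that of scale i + c. *)
Definition dies i k : bool :=
  (e * scale i < insertion_radius x0 k) && (insertion_radius x0 k <= e * scale (i + c)).

Lemma card_active i : (#|active i| <= 2 * \sum_(k < #|X|) dies i k)%N.
Proof.
apply: (@leq_trans (2 * #|net x0 (e * scale i) :\: net x0 (e * scale (i + c))|)).
  apply: card_nonisolated; first exact/ltW/close_radius_gt0.
  move=> x y xN yN xy; exact: le_lt_trans (scale_shift i) (net_sep xN yN xy).
by rewrite leq_mul2l /= card_netD.
Qed.

(** The increasing thresholds [e * scale i] cross a fixed radius once, and only the [c] indices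
    before the crossing qualify. *)
Lemma dies_window k : (\sum_(i < M.+1) dies i k <= c)%N.
Proof.
rewrite -big_mkcond sum1_card; apply: (@card_window _ _ (dies^~ k)).
move=> i j ij /andP[_ ki] /andP[kj _]; rewrite ltnNge; apply/negP => /scale_le.
by rewrite leNgt -(ltr_pM2l e0) (lt_le_trans kj ki).
Qed.

Lemma light_spanner :
  exists H : {set {set X}}, [/\ spanner (t * (2 + 16 * e)) H,
    (#|H| <= 2 * m * c * #|X|)%N
  & weight H <= (2 * m * c)%:R * (t * (1 + 2 * e) / e) * \sum_(k < #|X|) insertion_radius x0 k].
Proof.
have scale_graph i : exists E : {set {set X}}, [/\ is_graph E,
    (#|E| <= m * #|active i|)%N,
    forall a, a \in E -> diameter a <= t * close_radius i
  & forall u v, u \in active i -> v \in active i -> mdist u v <= close_radius i ->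
      linked E (t * close_radius i + t * close_radius i) u v].
  have [mu mu_dec] := Xdec (close_radius_gt0 i).
  exact: spanner_scale mu_dec _ _ delta0 delta1 m_large.
have [E /all_and4[Egraph Ecard Ediam Elink]] := choice scale_graph.
have Ecard2 i : (#|E i| <= 2 * m * \sum_(k < #|X|) dies i k)%N.
  apply: leq_trans (Ecard i) _.
  by rewrite [(2 * m)%N]mulnC -mulnA leq_mul2l card_active orbT.
have t0 : 0 < t by exact: lt_le_trans t1.
have k0 : 0 <= t * (2 + 16 * e) by rewrite mulr_ge0 ?ltW // addr_gt0 // mulr_gt0.
pose H := (\bigcup_(i < M.+1) E i)%SET.
have Hgraph : is_graph H by move=> a /finset.bigcupP[i _]; exact: Egraph.
exists H; split.
- apply: spanner_linked => // x y.
  (* Induction on the distance, measured by the number of pairs that are strictly closer. *)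
  have [N] := ubnP #|[set p : X * X | mdist p.1 p.2 < mdist x y]|.
  elim: N x y => // N IH x y; rewrite ltnS => cardN.
  have [->|xy] := eqVneq x y.
    by apply: linked_refl; rewrite mulr_ge0 ?mdist_ge0.
  have IHx a b : mdist a b < mdist x y -> linked H (t * (2 + 16 * e) * mdist a b) a b.
    move=> ab; apply: IH; apply: leq_trans cardN; apply: proper_card.
    apply/fintype.properP; split.
      by apply/fintype.subsetP => p; rewrite !inE => /lt_trans; apply.
    by exists (a, b); rewrite !inE ?ltxx.
  have [i iM /andP[dxy sxy]] := scale_approx xy.
  have d_gt0 : 0 < mdist x y by rewrite mdist_gt0.
  have s0 := scale_gt0 i.
  have sd : e * scale i < mdist x y.
    apply: le_lt_trans (_ : _ <= e * ((1 + e) * mdist x y)) _; first by rewrite ler_pM2l.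
    by rewrite mulrA gtr_pMl //; apply: small_constant.
  have sD : e * scale i < diameter [set: X].
    by apply: lt_le_trans sd _; rewrite mdist_diameter ?inE.
  have es0 : 0 <= e * scale i by rewrite mulr_ge0 // ltW.
  have [u uN xu] := net_cover x0 x es0 sD.
  have [v vN yv] := net_cover x0 y es0 sD.
  have uv : mdist u v <= close_radius i.
    apply: le_trans (metric_triangle u x v) _.
    have -> : close_radius i = e * scale i + (scale i + e * scale i).
      by rewrite /close_radius; ring.
    apply: lerD; first by rewrite metric_sym.
    by apply: le_trans (metric_triangle x y v) _; rewrite lerD.
  have luv : linked H (t * close_radius i + t * close_radius i) u v.
    (* Distinct close net points witness each other's activity; equal ones need no edge. *)
    have [<-|u_v] := eqVneq u v.
      by apply: linked_refl; rewrite addr_ge0 // mulr_ge0 ?ltW ?close_radius_gt0.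
    apply: linked_sub (Elink i _ _ _ _ uv).
    + exact: (finset.bigcup_sup (Ordinal (iM : (i < M.+1)%N))).
    + by rewrite inE uN; apply/existsP; exists v; rewrite vN u_v.
    + by rewrite inE vN; apply/existsP; exists u; rewrite uN eq_sym u_v metric_sym.
  have lxu := IHx x u (le_lt_trans xu sd).
  have lvy := linked_sym (IHx y v (le_lt_trans yv sd)).
  apply: linked_le (linked_trans (linked_trans lxu luv) lvy).
  apply: le_trans (stretch_constant t0 d_gt0 e0 e1 sxy).
  apply: lerD; first apply: lerD => //; apply: ler_wpM2l => //; by rewrite metric_sym.
- apply: leq_trans (unstable.card_big_setU _ _ _) _.
  apply: leq_trans (leq_sum _ (fun (i : 'I_M.+1) _ => Ecard2 i)) _.
  (* Summing over scales before points replaces the number of scales by [c]. *)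
  rewrite -big_distrr /= -[leqRHS]mulnA leq_mul2l exchange_big /=; apply/orP; right.
  apply: leq_trans (leq_sum _ (fun (k : 'I_#|X|) _ => dies_window k)) _.
  by rewrite sum_nat_const card_ord mulnC.
- apply: le_trans (weight_bigcup _) _.
  have wE (i : 'I_M.+1) : weight (E i) <=
      \sum_(k < #|X|) (2 * m)%:R * (t * (1 + 2 * e)) * ((dies i k)%:R * scale i).
    apply: (@le_trans _ _ (\sum_(a in E i) t * close_radius i)).
      by apply: ler_sum => a; exact: Ediam.
    rewrite sumr_const -[leLHS]mulr_natr.
    have tc0 : 0 <= t * close_radius i by rewrite mulr_ge0 ?ltW ?close_radius_gt0.
    apply: (@le_trans _ _
      (t * close_radius i * (2 * m * \sum_(k < #|X|) dies i k)%:R)).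
      by rewrite ler_wpM2l // ler_nat.
    rewrite natrM natr_sum !mulr_sumr; apply: ler_sum => k _.
    by rewrite /close_radius le_eqVlt; apply/orP; left; apply/eqP; ring.
  apply: le_trans (ler_sum _ (fun i _ => wE i)) _.
  rewrite exchange_big mulr_sumr /=; apply: ler_sum => k _.
  rewrite -mulr_sumr (natrM _ (2 * m) c).
  have -> : (2 * m)%:R * c%:R * (t * (1 + 2 * e) / e) * insertion_radius x0 k =
      (2 * m)%:R * (t * (1 + 2 * e)) * (c%:R * (insertion_radius x0 k / e)) by ring.
  apply: ler_wpM2l.
    apply: mulr_ge0 => //; apply: mulr_ge0; first exact: ltW.
    by rewrite addr_ge0 // mulr_ge0 // ltW.
  (* A point pays only at scales below its radius divided by [e]. *)
  have rk (i : 'I_M.+1) :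
      (dies i k)%:R * scale i <= (dies i k)%:R * (insertion_radius x0 k / e).
    case/boolP: (dies i k) => [/andP[ik _]|_]; last by rewrite !mul0r.
    by rewrite !mul1r ler_pdivlMr // mulrC ltW.
  apply: le_trans (ler_sum _ (fun i _ => rk i)) _.
  rewrite -mulr_suml -natr_sum.
  apply: ler_wpM2r; last by rewrite ler_nat dies_window.
  by rewrite divr_ge0 ?radius_ge0 // ltW.
Qed.

End LightSpanner.

(** * Choice of parameters and final constants *)

Section Bounds.
Context {R : realType}.

Lemma ln2_le1 : ln 2 <= 1 :> R.
Proof. exact: (@le_ln1Dx R 1). Qed.

Lemma ln2_gt0 : 0 < ln 2 :> R.
Proof. by rewrite ln_gt0 // ltr1n. Qed.

Lemma ln_le_log2 (n : nat) : (0 < n)%N -> ln n%:R <= log2 n%:R :> R.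
Proof.
move=> n0; rewrite /log2 ler_pdivlMr ?ln2_gt0 //.
by rewrite ler_piMr ?ln2_le1 // ln_ge0 // ler1n.
Qed.

Lemma log2_ge1 (n : nat) : (1 < n)%N -> 1 <= log2 n%:R :> R.
Proof.
move=> n1; rewrite /log2 ler_pdivlMr ?ln2_gt0 // mul1r.
by rewrite ler_ln ?posrE ?ltr0n ?ler_nat // ltnW.
Qed.

Lemma log2_ge0 (n : nat) : 0 <= log2 n%:R :> R.
Proof.
rewrite /log2 divr_ge0 ?(ltW ln2_gt0) //.
case: n => [|n]; first by rewrite ln0.
by rewrite ln_ge0 // ler1n.
Qed.

(** With [m] above [2 * ln n / delta], [(1 - delta) ^+ m <= expR (- delta * m)] drops below
    [n ^- 2]. *)
Lemma few_partitions (n : nat) (delta : R) :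
  (1 < n)%N -> 0 < delta -> delta <= 1 ->
  exists m : nat, (1 - delta) ^+ m * (n ^ 2)%:R < 1 /\
    m%:R <= 3 * (log2 n%:R / delta).
Proof.
move=> n1 d0 d1; have n0 : (0 : R) < n%:R by rewrite ltr0n ltnW.
have L1 := log2_ge1 n1; have lnL := ln_le_log2 (ltnW n1).
have ln0 : 0 <= ln n%:R :> R by rewrite ln_ge0 // ler1n ltnW.
pose m := (Num.trunc (2 * ln n%:R / delta)).+1; exists m; split.
  have mlt : 2 * ln n%:R < delta * m%:R.
    by rewrite [ltRHS]mulrC -ltr_pdivrMr //; exact: truncnS_gt.
  have -> : (n ^ 2)%:R = expR (2 * ln n%:R) :> R.
    by rewrite natrX expRM_natl lnK ?posrE.
  apply: (@le_lt_trans _ _ (expR (- delta * m%:R) * expR (2 * ln n%:R))).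
    rewrite ler_wpM2r ?expR_ge0 // expRM_natr lerXn2r ?nnegrE ?subr_ge0 ?expR_ge0 //.
    exact: expR_ge1Dx.
  by rewrite -expRD expR_lt1 mulNr addrC subr_lt0.
rewrite /m -[leLHS]natr1; apply: (@le_trans _ _ (2 * ln n%:R / delta + 1)).
  by rewrite lerD2r truncn_le divr_ge0 ?mulr_ge0 // ltW.
(* The 1 from rounding, written [delta / delta], is absorbed because [delta <= 1 <= log2 n]. *)
rewrite mulrA -[X in _ + X](divff (lt0r_neq0 d0)) -mulrDl ler_pM2r ?invr_gt0 //.
lra.
Qed.

Lemma mdist_lower_bound (X : finMetricType R) :
  exists2 d : R, 0 < d & forall x y : X, x != y -> d <= mdist x y.
Proof.
exists (\big[Num.min/1]_(p : X * X | p.1 != p.2) mdist p.1 p.2).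
  by apply/bigmin_gtP; split=> // p; rewrite mdist_gt0.
by move=> x y xy; exact: (@bigmin_le_cond _ _ _ 1 (x, y)).
Qed.

Lemma light_spanner_bounds (X : finMetricType R) (t delta e : R) :
  (1 < #|X|)%N -> 1 <= t -> 0 < delta -> delta <= 1 -> decomposable X t delta ->
  0 < e -> e <= 1 / 128 ->
  exists H : {set {set X}}, [/\ spanner (t * (2 + 16 * e)) H,
    weight H <= 192 / e ^+ 3 * (t / delta * log2 #|X|%:R ^+ 2) * @mst_weight R X
  & #|H|%:R <= 24 / e ^+ 2 * (#|X|%:R / delta * log2 #|X|%:R) :> R].
Proof.
move=> X2 t1 d0 d1 Xdec e0 e1.
have [x0 _] : exists x : X, x \in X by apply/card_gt0P; exact: ltnW.
have [r r0 rX] := mdist_lower_bound X.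
have [m [m_large m_le]] := few_partitions X2 d0 d1.
have t0 : 0 < t by exact: lt_le_trans t1.
have e2 : 0 < e ^+ 2 by rewrite exprn_gt0.
have L1 := log2_ge1 X2; have lnL := ln_le_log2 (ltnW X2).
set L := log2 _ in L1 lnL m_le *.
pose c := (Num.trunc (3 / e ^+ 2)).+1.
have c_large : 3 <= c%:R * e ^+ 2.
  by rewrite -ler_pdivrMr //; apply: ltW; exact: truncnS_gt.
have c_le : c%:R <= 4 / e ^+ 2.
  rewrite /c -[leLHS]natr1; apply: (@le_trans _ _ (3 / e ^+ 2 + 1)).
    by rewrite lerD2r truncn_le divr_ge0 // ltW.
  have -> : 4 / e ^+ 2 = 3 / e ^+ 2 + 1 / e ^+ 2 :> R by rewrite -mulrDl; congr (_ / _); ring.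
  rewrite lerD2l ler_pdivlMr // mul1r expr_le1 // ?(ltW e0) //.
  by apply: le_trans e1 _; lra.
(* Bernoulli's inequality lets [M] scales reach the diameter; [M] depends on the aspect ratio but
   enters neither bound. *)
pose M := (Num.trunc (diameter [set: X] / (r * e))).+1.
have M_large : diameter [set: X] <= r * (1 + e) ^+ M.
  apply: (@le_trans _ _ (r * (1 + M%:R * e))); last first.
    by rewrite ler_pM2l // exprn_ge1Dn // ltW.
  rewrite mulrDr mulr1 mulrCA; apply: ler_wpDl; first exact: ltW.
  by rewrite -ler_pdivrMr ?mulr_gt0 //; apply: ltW; exact: truncnS_gt.
have [H [Hspan Hcard Hweight]] :=
  light_spanner x0 t1 (ltW d0) d1 e0 e1 r0 rX M_large c_large m_large Xdec.
have mc_le : (2 * m * c)%:R <= 24 / e ^+ 2 * (L / delta).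
  rewrite natrM (_ : 24 / _ * _ = 2 * (3 * (L / delta)) * (4 / e ^+ 2)); last by ring.
  by rewrite ler_pM // natrM ler_pM2l.
exists H; split=> //.
  apply: le_trans Hweight _.
  have mst0 := mst_weight_ge0 X2.
  (* Here [1 + 2 * e <= 2] and [1 + ln n <= 2 * L], so the constant is [24 * 2 * 2 * 2 = 192]. *)
  apply: (@le_trans _ _ (24 / e ^+ 2 * (L / delta) * (t * 2 / e) *
      (2 * @mst_weight R X * (2 * L)))); last first.
    rewrite le_eqVlt; apply/orP; left; apply/eqP.
    by field; rewrite !lt0r_neq0.
  apply: ler_pM.
  - by rewrite mulr_ge0 // divr_ge0 ?mulr_ge0 ?addr_ge0 ?mulr_ge0 // ltW.
  - by apply: sumr_ge0 => k _; exact: radius_ge0.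
  - apply: ler_pM => //.
      by rewrite divr_ge0 ?mulr_ge0 ?addr_ge0 ?mulr_ge0 // ltW.
    rewrite ler_pM2r ?invr_gt0 // ler_pM2l //.
    lra.
  apply: le_trans (radius_sum x0 X2) _.
  rewrite ler_wpM2l ?mulr_ge0 //.
  lra.
apply: (@le_trans _ _ (2 * m * c * #|X|)%:R); first by rewrite ler_nat.
rewrite natrM (_ : _ / _ * _ = 24 / e ^+ 2 * (L / delta) * #|X|%:R); last by ring.
by rewrite ler_wpM2r.
Qed.

Lemma empty_spanner (X : finMetricType R) (k : R) :
  (#|X| <= 1)%N -> spanner k (finset.set0 : {set {set X}}).
Proof.
move=> X1; apply: spanner_linked => [a|x y]; first by rewrite inE.
have -> : x = y by apply: (fintype_le1P X1).
by apply: linked_refl; rewrite mdistxx mulr0.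
Qed.

End Bounds.

(* O_eps(f) is rendered as: at most q(1/eps) * f for a polynomial q independent
   of X, t, delta and eps.  The factor log t of the number of edges is read as
   max(1, log t), as it must be for t close to 1. *)
Theorem theorem1 :
  forall R : realType,
  exists q1 q2 : {poly R},
  forall (X : finMetricType R) (n : nat) (t delta : R),
    #|X| = n ->
    1 <= t -> 0 < delta -> delta <= 1 ->
    decomposable X t delta ->
    forall eps : R, 0 < eps -> eps < 1 / 8 ->
    exists H : {set {set X}},
      [/\ spanner (t * (2 + eps)) H,
          lightness H <= q1.[1 / eps] * (t / delta * log2 n%:R ^+ 2)
        & (#|H|%:R : R) <=
            q2.[1 / eps] * (n%:R / delta * log2 n%:R * Num.max 1 (log2 t))].
Proof.
(* The earlier bounds are used with [e = eps / 16], which turns [16 * e] into [eps] and [1 / 8] into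
   [1 / 128]. *)
move=> R; exists ((192 * 16 ^+ 3) *: 'X^3), ((24 * 16 ^+ 2) *: 'X^2).
move=> X n t delta <- t1 d0 d1 Xdec eps eps0 eps1; rewrite !hornerZ !hornerXn.
have q0 : 0 <= 1 / eps by rewrite divr_ge0 // ltW.
have max1 : 1 <= Num.max 1 (log2 t) by rewrite le_max lexx.
have n_pos : 0 <= #|X|%:R / delta * log2 #|X|%:R :> R.
  by rewrite mulr_ge0 ?log2_ge0 // divr_ge0 // ltW.
have coef_ge0 (a : R) (k : nat) : 0 <= a -> 0 <= a * 16 ^+ k * (1 / eps) ^+ k.
  by move=> a0; apply: mulr_ge0; [apply: mulr_ge0 => // |]; exact: exprn_ge0.
(* With at most one point [log2 n] is 0 and both bounds vanish, so the graph must be empty. *)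
have [X1|X2] := leqP #|X| 1.
  exists finset.set0; split; first exact: empty_spanner.
    rewrite /lightness /weight big_set0 mul0r; apply: mulr_ge0; first exact: coef_ge0.
    rewrite mulr_ge0 ?exprn_ge0 ?log2_ge0 // divr_ge0 ?(le_trans ler01 t1) //.
    exact: ltW.
  rewrite cards0; apply: mulr_ge0; first exact: coef_ge0.
  by apply: mulr_ge0 => //; exact: le_trans max1.
have e0 : 0 < eps / 16 by rewrite divr_gt0.
have e1 : eps / 16 <= 1 / 128 by lra.
have [H [Hspan Hweight Hcard]] := light_spanner_bounds X2 t1 d0 d1 Xdec e0 e1.
have mst_gt0 : 0 < @mst_weight R X.
  have [x [y [_ _ xy]]] := card_gt1P X2.
  apply: lt_le_trans (diameter_mst_weight X2).
  by apply: lt_le_trans (@mdist_diameter _ _ _ x y _ _); rewrite ?mdist_gt0 ?inE.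
exists H; split.
- by have -> : 2 + eps = 2 + 16 * (eps / 16) by field.
- rewrite /lightness ler_pdivrMr //.
  suff <- : 192 / (eps / 16) ^+ 3 = 192 * 16 ^+ 3 * (1 / eps) ^+ 3 by [].
  by field; rewrite lt0r_neq0.
apply: (le_trans Hcard).
have -> : 24 / (eps / 16) ^+ 2 = 24 * 16 ^+ 2 * (1 / eps) ^+ 2.
  by field; rewrite lt0r_neq0.
apply: ler_wpM2l; first exact: coef_ge0.
(* The edge bound already holds without the factor [Num.max 1 (log2 t)], which is at least 1. *)
exact: ler_peMr.
Qed.
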